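(* Let $H$ be a definite Bethe--Salpeter matrix. A structured BSE Krylov decomposition of type II of $H$ of order $k$ keeps its structure under block diagonal similarity transformations of the form $\begin{bmatrix}Q & 0\\ 0 & Q^{-*}\end{bmatrix}$, with $Q\in\mathbb{R}^{k\times k}$ invertible. That is, applying such a similarity transformation to a structured BSE Krylov decomposition of type II yields again a structured BSE Krylov decomposition of type II.
   Context: Notation: $\overline{\,\cdot\,}$ is entrywise complex conjugation, $\cdot^*$ conjugate transpose, $Q^{-*}=(Q^{-1})^*$. For matrices $U,V$ of equal dimensions, $\phi(U,V):=\begin{bmatrix}U & \overline{V}\\ V & \overline{U}\end{bmatrix}$. Definite Bethe--Salpeter matrix: $H=\begin{bmatrix}R & C\\ -\overline{C} & -\overline{R}\end{bmatrix}\in\mathbb{C}^{2n\times 2n}$ with $R=R^*$, $C=C^T$ in $\mathbb{C}^{n\times n}$, such that $\hat H=\begin{bmatrix}R & C\\ \overline{C} & \overline{R}\end{bmatrix}$ is (Hermitian) positive definite. Type I: a structured BSE Krylov decomposition of type I (of order $k$) is a relation $$H\phi(W_k,Z_k)=\phi(W_k,Z_k)\begin{bmatrix}A_k & B_k\\ -B_k & -A_k\end{bmatrix}+\phi(w_{k+1},z_{k+1})\begin{bmatrix}a_{k+1}^* & b_{k+1}^*\\ -b_{k+1}^* & -a_{k+1}^*\end{bmatrix},$$ with $W_k,Z_k\in\mathbb{C}^{n\times k}$, $w_{k+1},z_{k+1}\in\mathbb{C}^n$, and $$A_k=\tfrac{F_k+K_k}{2},\quad B_k=\tfrac{F_k-K_k}{2},\quad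 a_{k+1}=\tfrac{f_{k+1}+k_{k+1}}{2},\quad b_{k+1}=\tfrac{f_{k+1}-k_{k+1}}{2},$$ for some symmetric positive definite $F_k,K_k\in\mathbb{R}^{k\times k}$ and vectors $f_{k+1},k_{k+1}\in\mathbb{R}^k$, where the columns of $\phi([W_k,w_{k+1}],[Z_k,z_{k+1}])$ are linearly independent, and either $f_{k+1}=0$ or $k_{k+1}=0$. Type II: a structured BSE Krylov decomposition of type II (of order $k$) is a relation $$H\begin{bmatrix}U_k & V_k\\ \overline{U}_k & -\overline{V}_k\end{bmatrix}=\begin{bmatrix}U_k & V_k\\ \overline{U}_k & -\overline{V}_k\end{bmatrix}\begin{bmatrix}0 & K_k\\ F_k & 0\end{bmatrix}+\begin{bmatrix}u_{k+1} & v_{k+1}\\ \overline{u}_{k+1} & -\overline{v}_{k+1}\end{bmatrix}\begin{bmatrix}0 & k_{k+1}^*\\ f_{k+1}^* & 0\end{bmatrix}$$ obtained by applying a similarity transformation with the symmetric orthogonal matrix $\hat G=\frac{1}{\sqrt2}\begin{bmatrix}I_k & I_k\\ I_k & -I_k\end{bmatrix}$ to a type I decomposition, where $F_k,K_k,f_{k+1},k_{k+1}$ are the same as in the type I decomposition (so $F_k,K_k$ are real symmetric positive definite, and either $f_{k+1}=0$ or $k_{k+1}=0$). Explicitly, $U_k=(W_k+\overline{Z}_k)/\sqrt2$, $V_k=(W_k-\overline{Z}_k)/\sqrt2$, and likewise $u_{k+1}=(w_{k+1}+\overline{z}_{k+1})/\sqrt2$, $v_{k+1}=(w_{k+1}-\overline{z}_{k+1})/\sqrt2$.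 Similarity transformation: applying a similarity transformation with an invertible matrix $G$ to a relation $HX=XM+EN$ (basis $X$, Rayleigh quotient $M$, residual term $EN$) means passing to $H(XG)=(XG)(G^{-1}MG)+E(NG)$. *)

(* Defs.v *)
From mathcomp Require Import all_boot all_order all_algebra.
From mathcomp Require Import reals.
From mathcomp Require Import complex.

Set Implicit Arguments.
Unset Strict Implicit.
Unset Printing Implicit Defensive.

Import Order.TTheory GRing.Theory Num.Theory.
Local Open Scope ring_scope.
Local Open Scope sesquilinear_scope.

(* The real numbers are an arbitrary [R : realType] and the
   complex numbers are [R[i]].  [A ^t*] is the library's conjugate transpose;
   the order on [R[i]] is such that [0 < z] forces [z] to be real. *)

Definition conj_mx (R : realType) (m n : nat) (A : 'M[R[i]]_(m, n)) :
  'M[R[i]]_(m, n) := map_mx Num.conj A.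

Definition cplx_mx (R : realType) (m n : nat) (A : 'M[R]_(m, n)) :
  'M[R[i]]_(m, n) := map_mx (real_complex R) A.

Definition hermitian_posdef (R : realType) (m : nat) (A : 'M[R[i]]_m) : Prop :=
  A ^t* = A /\ forall x : 'cV[R[i]]_m, x != 0 -> 0 < (x ^t* *m A *m x) 0 0.

Definition symmetric_posdef (R : realType) (m : nat) (A : 'M[R]_m) : Prop :=
  A^T = A /\ forall x : 'cV[R]_m, x != 0 -> 0 < (x^T *m A *m x) 0 0.

Definition phi_mx (R : realType) (n k : nat) (U V : 'M[R[i]]_(n, k)) :
  'M[R[i]]_(n + n, k + k) :=
  block_mx U (conj_mx V) V (conj_mx U).

Definition definite_BSE (R : realType) (n : nat) (H : 'M[R[i]]_(n + n)) : Prop :=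
  exists A B : 'M[R[i]]_n,
    [/\ H = block_mx A B (- conj_mx B) (- conj_mx A),
        A ^t* = A,
        B^T = B
      & hermitian_posdef (block_mx A B (conj_mx B) (conj_mx A))].

(* The data X, M, E, N of a relation H X = X M + E N. *)
Record krylov_rel (R : realType) (m p r : nat) := KrylovRel {
  basis : 'M[R[i]]_(m, p);
  rayleigh : 'M[R[i]]_p;
  residual : 'M[R[i]]_(m, r);
  residual_coef : 'M[R[i]]_(r, p) }.

Definition krylov_holds (R : realType) (m p r : nat) (H : 'M[R[i]]_m)
    (d : krylov_rel R m p r) : Prop :=
  H *m basis d = basis d *m rayleigh d + residual d *m residual_coef d.

Definition similarity (R : realType) (m p r : nat) (G : 'M[R[i]]_p)
    (d : krylov_rel R m p r) : krylov_rel R m p r :=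
  KrylovRel (basis d *m G) (invmx G *m rayleigh d *m G)
            (residual d) (residual_coef d *m G).

(* Equality of relations, in which the residual is one term, regardless of its
   factorization into E and N. *)
Definition same_rel (R : realType) (m p r : nat) (d1 d2 : krylov_rel R m p r) :
    Prop :=
  [/\ basis d1 = basis d2,
      rayleigh d1 = rayleigh d2
    & residual d1 *m residual_coef d1 = residual d2 *m residual_coef d2].

Definition typeI_rel (R : realType) (n k : nat) (W Z : 'M[R[i]]_(n, k))
    (w z : 'cV[R[i]]_n) (F K : 'M[R]_k) (fv kv : 'cV[R]_k) :
    krylov_rel R (n + n) (k + k) (1 + 1) :=
  let A := cplx_mx (2^-1 *: (F + K)) in
  let B := cplx_mx (2^-1 *: (F - K)) in
  let a := cplx_mx (2^-1 *: (fv + kv)) in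
  let b := cplx_mx (2^-1 *: (fv - kv)) in
  KrylovRel (phi_mx W Z) (block_mx A B (- B) (- A))
            (phi_mx w z) (block_mx (a ^t*) (b ^t*) (- b ^t*) (- a ^t*)).

Definition is_typeI (R : realType) (n k : nat) (H : 'M[R[i]]_(n + n))
    (W Z : 'M[R[i]]_(n, k)) (w z : 'cV[R[i]]_n)
    (F K : 'M[R]_k) (fv kv : 'cV[R]_k) : Prop :=
  [/\ krylov_holds H (typeI_rel W Z w z F K fv kv),
      symmetric_posdef F,
      symmetric_posdef K,
      row_free (phi_mx (row_mx W w) (row_mx Z z))^T
    & fv = 0 \/ kv = 0].

Definition typeII_rel (R : realType) (n k : nat) (U V : 'M[R[i]]_(n, k))
    (u v : 'cV[R[i]]_n) (F K : 'M[R]_k) (fv kv : 'cV[R]_k) :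
    krylov_rel R (n + n) (k + k) (1 + 1) :=
  KrylovRel (block_mx U V (conj_mx U) (- conj_mx V))
            (block_mx 0 (cplx_mx K) (cplx_mx F) 0)
            (block_mx u v (conj_mx u) (- conj_mx v))
            (block_mx 0 (cplx_mx kv ^t*) (cplx_mx fv ^t*) 0).

Definition Ghat (R : realType) (k : nat) : 'M[R[i]]_(k + k) :=
  (sqrtC 2)^-1 *: block_mx 1%:M 1%:M 1%:M (- 1%:M).

(* The residual factors E and N of a type II decomposition differ from those of
   [similarity (Ghat R k) (typeI_rel ...)] (only their product is the same), so
   that the vectors u and v have to be specified separately. *)
Definition is_typeII (R : realType) (n k : nat) (H : 'M[R[i]]_(n + n))
    (d : krylov_rel R (n + n) (k + k) (1 + 1)) : Prop :=
  krylov_holds H d /\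
  exists (W Z : 'M[R[i]]_(n, k)) (w z : 'cV[R[i]]_n)
         (F K : 'M[R]_k) (fv kv : 'cV[R]_k),
    [/\ is_typeI H W Z w z F K fv kv,
        same_rel d (similarity (Ghat R k) (typeI_rel W Z w z F K fv kv))
      & d = typeII_rel
              ((sqrtC 2)^-1 *: (W + conj_mx Z)) ((sqrtC 2)^-1 *: (W - conj_mx Z))
              ((sqrtC 2)^-1 *: (w + conj_mx z)) ((sqrtC 2)^-1 *: (w - conj_mx z))
              F K fv kv].

Definition block_diag_transform (R : realType) (k : nat) (Q : 'M[R]_k) :
    'M[R[i]]_(k + k) :=
  block_mx (cplx_mx Q) 0 0 ((invmx (cplx_mx Q)) ^t*).

(* Main.v *)
Require Import Defs.
From mathcomp Require Import all_boot all_order all_algebra.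
From mathcomp Require Import reals.
From mathcomp Require Import complex.
Local Open Scope ring_scope.

(** The matrix [diag(Q, P)] with [P = Q^-T] is real and block diagonal, so it
    acts on the two halves of a type II basis separately and commutes with the
    entrywise conjugation that links the upper and lower halves: [U] becomes
    [U Q] and [V] becomes [V P].  Its inverse is [diag(P^T, Q^T)], and this
    choice of the second block is exactly what turns the similarity of the
    antidiagonal Rayleigh quotient into two congruences,
    [F] to [Q^T F Q] and [K] to [P^T K P], which preserve symmetry and positive
    definiteness.  The residual vectors [u] and [v] stay, and the coefficients
    become [Q^T f] and [P^T k], so a vanishing one remains zero.

    What remains is that a decomposition of this shape comes from one of type I.
    Since [Ghat] is an involution, [W] and [Z] can be recovered from [U] and
    [V], and both the Krylov relation and the linear independence of the extended
    basis pass through multiplication by [Ghat].  Hence type II is characterized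
    by its own blocks ([is_typeIIP]), with no reference to [W] and [Z], and
    the argument above applies to that characterization.  Linear independence
    survives because the extended basis gets multiplied by
    [diag(diag(Q, 1), diag(P, 1))], which is invertible. *)

Set Implicit Arguments.
Unset Strict Implicit.
Unset Printing Implicit Defensive.

Import Order.TTheory GRing.Theory Num.Theory.
Local Open Scope sesquilinear_scope.

(** * Conjugation and the embedding of real matrices *)

Section Embedding.
Variable R : realType.
Implicit Types m n p : nat.

Lemma conj_mxD m n (A B : 'M[R[i]]_(m, n)) :
  conj_mx (A + B) = conj_mx A + conj_mx B.
Proof. exact: map_mxD. Qed.

Lemma conj_mxN m n (A : 'M[R[i]]_(m, n)) : conj_mx (- A) = - conj_mx A.
Proof. exact: map_mxN. Qed.

Lemma conj_mxM m n p (A : 'M[R[i]]_(m, n)) (B : 'M_(n, p)) :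
  conj_mx (A *m B) = conj_mx A *m conj_mx B.
Proof. exact: map_mxM. Qed.

Lemma conj_mxK m n : involutive (@conj_mx R m n).
Proof. by move=> A; apply/matrixP=> i j; rewrite !mxE conjCK. Qed.

Lemma conj_cplx_mx m n (A : 'M[R]_(m, n)) : conj_mx (cplx_mx A) = cplx_mx A.
Proof.
apply/matrixP=> i j; rewrite !mxE; apply: conj_Creal.
by rewrite complex_real.
Qed.

Lemma cplx_mx_adj m n (A : 'M[R]_(m, n)) : (cplx_mx A) ^t* = cplx_mx A^T.
Proof. by rewrite -[RHS]conj_cplx_mx /cplx_mx map_trmx. Qed.

Lemma cplx_mxM m n p (A : 'M[R]_(m, n)) (B : 'M_(n, p)) :
  cplx_mx (A *m B) = cplx_mx A *m cplx_mx B.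
Proof. exact: map_mxM. Qed.

Lemma conj_mxZ_invsqrt2 m n (A : 'M[R[i]]_(m, n)) :
  conj_mx ((sqrtC 2)^-1 *: A) = (sqrtC 2)^-1 *: conj_mx A.
Proof.
apply/matrixP=> i j; rewrite !mxE rmorphM; congr (_ * _).
by apply: conj_Creal; rewrite ger0_real // invr_ge0 sqrtC_ge0 ler0n.
Qed.

Lemma invsqrt2_sqr : (sqrtC 2)^-1 * (sqrtC 2)^-1 = 2^-1 :> R[i].
Proof. by rewrite -invfM -expr2 sqrtCK. Qed.

Lemma halves m n (A : 'M[R[i]]_(m, n)) : 2^-1 *: (A + A) = A.
Proof. by rewrite -mulr2n -[A *+ 2]scaler_nat scalerA mulVf ?scale1r ?pnatr_eq0. Qed.

End Embedding.

(** * Relations up to similarity *)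

Section Relations.
Variable R : realType.
Implicit Types n m p q r : nat.

Lemma krylov_holds_similarity m p r (H : 'M_m) (G : 'M_p)
    (d : krylov_rel R m p r) :
  G \in unitmx -> krylov_holds H (similarity G d) <-> krylov_holds H d.
Proof.
rewrite /krylov_holds; case: d => X M E N uG /=.
rewrite -!mulmxA mulKVmx // !mulmxA -mulmxDl; split=> [eqG | -> //].
by rewrite -[LHS](mulmxK uG) eqG mulmxK.
Qed.

Lemma krylov_holds_same_rel m p r (H : 'M_m) (d1 d2 : krylov_rel R m p r) :
  same_rel d1 d2 -> krylov_holds H d1 <-> krylov_holds H d2.
Proof. by rewrite /krylov_holds => -[-> -> ->]. Qed.

Lemma symmetric_posdef_congr m (F Q : 'M[R]_m) :
  Q \in unitmx -> symmetric_posdef F -> symmetric_posdef (Q^T *m F *m Q).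
Proof.
move=> uQ [symF posF]; split=> [|x x0].
  by rewrite !trmx_mul trmxK symF mulmxA.
rewrite !mulmxA -trmx_mul -mulmxA; apply: posF.
by apply: contraNneq x0 => Qx0; rewrite -[x](mulKmx uQ) Qx0 mulmx0.
Qed.

Lemma row_free_trmx_mulmx (F : fieldType) m p (X : 'M[F]_(m, p)) (G : 'M_p) :
  G \in unitmx -> row_free (X *m G)^T = row_free X^T.
Proof.
move=> uG; rewrite /row_free trmx_mul eqmxMfull //.
by rewrite row_full_unit unitmx_tr.
Qed.

Lemma unitmx_block_diag (F : fieldType) m p (A : 'M[F]_m) (B : 'M_p) :
  A \in unitmx -> B \in unitmx -> block_mx A 0 0 B \in unitmx.
Proof. by rewrite !unitmxE det_ublock unitrM => -> ->. Qed.

Lemma unitmx_cplx_mx m (Q : 'M[R]_m) : (cplx_mx Q \in unitmx) = (Q \in unitmx).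
Proof. exact: map_unitmx. Qed.

End Relations.

(** * Type II decompositions in terms of their own blocks *)

Section TypeII.
Variable R : realType.
Implicit Types n k p q : nat.

Definition typeII_basis n k (U V : 'M[R[i]]_(n, k)) : 'M[R[i]]_(n + n, k + k) :=
  block_mx U V (conj_mx U) (- conj_mx V).

Lemma Ghat_invol k : Ghat R k *m Ghat R k = 1%:M.
Proof.
rewrite /Ghat -scalemxAl -scalemxAr scalerA invsqrt2_sqr mulmx_block.
rewrite !(mul1mx, mulmx1, mulNmx, mulmxN) opprK subrr scale_block_mx scaler0.
by rewrite halves -scalar_mx_block.
Qed.

Lemma Ghat_unit k : Ghat R k \in unitmx.
Proof. by case/mulmx1_unit: (Ghat_invol k). Qed.

Lemma invmx_Ghat k : invmx (Ghat R k) = Ghat R k.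
Proof. by rewrite -[LHS]mulmx1 -(Ghat_invol k) mulKmx ?Ghat_unit. Qed.

Lemma phi_mx_Ghat n k (W Z : 'M[R[i]]_(n, k)) :
  phi_mx W Z *m Ghat R k =
  typeII_basis ((sqrtC 2)^-1 *: (W + conj_mx Z)) ((sqrtC 2)^-1 *: (W - conj_mx Z)).
Proof.
rewrite /Ghat -scalemxAr mulmx_block !mulmx1 !mulmxN !mulmx1 scale_block_mx.
rewrite /typeII_basis !conj_mxZ_invsqrt2 !conj_mxD conj_mxN conj_mxK.
by rewrite -scalerN opprB [Z + _]addrC.
Qed.

(** Both the Rayleigh quotient and the residual coefficients of type I have the
    block pattern of this lemma, the latter with [p = 1]. *)
Lemma Ghat_conj_block p q (X Y : 'M[R[i]]_(p, q)) :
  Ghat R p *m block_mx X Y (- Y) (- X) *m Ghat R q =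
  block_mx 0 (X - Y) (X + Y) 0.
Proof.
rewrite /Ghat -!scalemxAl -scalemxAr scalerA invsqrt2_sqr !mulmx_block.
rewrite !(mul1mx, mulmx1, mulNmx, mulmxN) !opprK scale_block_mx.
by rewrite [Y + X]addrC opprB addrA subrK subrr !addrN ?halves ?scaler0.
Qed.

Lemma half_sum m n (F K : 'M[R]_(m, n)) :
  cplx_mx (2^-1 *: (F + K)) + cplx_mx (2^-1 *: (F - K)) = cplx_mx F.
Proof.
rewrite /cplx_mx -map_mxD -scalerDr addrACA subrr addr0 -mulr2n -[F *+ 2]scaler_nat.
by rewrite scalerA mulVf ?scale1r ?pnatr_eq0.
Qed.

Lemma half_diff m n (F K : 'M[R]_(m, n)) :
  cplx_mx (2^-1 *: (F + K)) - cplx_mx (2^-1 *: (F - K)) = cplx_mx K.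
Proof. by rewrite [F + K]addrC -[F - K]opprB scalerN /cplx_mx map_mxN opprK half_sum. Qed.

Lemma same_rel_typeII n k (W Z : 'M[R[i]]_(n, k)) (w z : 'cV_n)
    (F K : 'M_k) fv kv :
  same_rel
    (typeII_rel
       ((sqrtC 2)^-1 *: (W + conj_mx Z)) ((sqrtC 2)^-1 *: (W - conj_mx Z))
       ((sqrtC 2)^-1 *: (w + conj_mx z)) ((sqrtC 2)^-1 *: (w - conj_mx z))
       F K fv kv)
    (similarity (Ghat R k) (typeI_rel W Z w z F K fv kv)).
Proof.
split=> /=; first by rewrite phi_mx_Ghat.
  by rewrite invmx_Ghat Ghat_conj_block half_sum half_diff.
rewrite -[block_mx _ _ _ _]/(typeII_basis _ _) -phi_mx_Ghat.
(* The residual factors of type II arise by inserting [Ghat *m Ghat = 1]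
   between those of type I. *)
rewrite -[in RHS](mulmx1 (phi_mx w z)) -(Ghat_invol 1) -!mulmxA; do 2!congr (_ *m _).
rewrite mulmxA !cplx_mx_adj [(_ *: (fv + kv))^T]linearZ [(_ *: (fv - kv))^T]linearZ.
by rewrite linearD linearB /= Ghat_conj_block half_sum half_diff.
Qed.

Lemma conj_row_mx n p q (A : 'M[R[i]]_(n, p)) (B : 'M_(n, q)) :
  conj_mx (row_mx A B) = row_mx (conj_mx A) (conj_mx B).
Proof. exact: map_row_mx. Qed.

Lemma row_free_phi_mx n k (W Z : 'M[R[i]]_(n, k)) :
  row_free (phi_mx W Z)^T =
  row_free (typeII_basis ((sqrtC 2)^-1 *: (W + conj_mx Z))
                         ((sqrtC 2)^-1 *: (W - conj_mx Z)))^T.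
Proof. by rewrite -phi_mx_Ghat row_free_trmx_mulmx ?Ghat_unit. Qed.

Lemma typeI_blocksK n k (U V : 'M[R[i]]_(n, k)) :
  let s := (sqrtC 2)^-1 in
  let W := s *: (U + V) in let Z := conj_mx (s *: (U - V)) in
  s *: (W + conj_mx Z) = U /\ s *: (W - conj_mx Z) = V.
Proof.
rewrite /= conj_mxK -scalerDr -scalerBr !scalerA invsqrt2_sqr opprB.
by rewrite addrACA subrr addr0 halves addrC addrA subrK halves.
Qed.

Definition typeII_conditions n k (H : 'M[R[i]]_(n + n)) (U V : 'M[R[i]]_(n, k))
    (u v : 'cV[R[i]]_n) (F K : 'M[R]_k) (fv kv : 'cV[R]_k) : Prop :=
  [/\ krylov_holds H (typeII_rel U V u v F K fv kv),
      symmetric_posdef F,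
      symmetric_posdef K,
      row_free (typeII_basis (row_mx U u) (row_mx V v))^T
    & fv = 0 \/ kv = 0].

(** The type I data are determined by the type II blocks because [Ghat] is
    invertible, so their existence is no extra condition. *)
Lemma is_typeIIP n k (H : 'M[R[i]]_(n + n))
    (d : krylov_rel R (n + n) (k + k) (1 + 1)) :
  is_typeII H d <->
  exists U V u v F K fv kv,
    typeII_conditions H U V u v F K fv kv /\ d = typeII_rel U V u v F K fv kv.
Proof.
have row_mx_combD (s : R[i]) (W Z : 'M_(n, k)) (w z : 'cV_n) :
    row_mx (s *: (W + conj_mx Z)) (s *: (w + conj_mx z)) =
    s *: (row_mx W w + conj_mx (row_mx Z z)).
  by rewrite conj_row_mx add_row_mx scale_row_mx.
have row_mx_combB (s : R[i]) (W Z : 'M_(n, k)) (w z : 'cV_n) :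
    row_mx (s *: (W - conj_mx Z)) (s *: (w - conj_mx z)) =
    s *: (row_mx W w - conj_mx (row_mx Z z)).
  by rewrite conj_row_mx opp_row_mx add_row_mx scale_row_mx.
split=> [[holds [W [Z [w [z [F [K [fv [kv [[_ pF pK free fk0] _ def_d]]]]]]]]]]|].
  rewrite def_d in holds *; do 8!eexists; split; last by [].
  by split=> //; rewrite row_mx_combD row_mx_combB -row_free_phi_mx.
move=> [U [V [u [v [F [K [fv [kv [[holds pF pK free fk0] ->]]]]]]]]].
split=> //; pose s : R[i] := (sqrtC 2)^-1.
have [defU defV] := typeI_blocksK U V; have [defu defv] := typeI_blocksK u v.
exists (s *: (U + V)), (conj_mx (s *: (U - V))).
exists (s *: (u + v)), (conj_mx (s *: (u - v))), F, K, fv, kv.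
have := same_rel_typeII (s *: (U + V)) (conj_mx (s *: (U - V)))
  (s *: (u + v)) (conj_mx (s *: (u - v))) F K fv kv.
rewrite defU defV defu defv => same; split=> //; split=> //.
  apply/(krylov_holds_similarity _ _ (Ghat_unit k)).
  exact/(krylov_holds_same_rel H same).
by rewrite row_free_phi_mx -row_mx_combD -row_mx_combB defU defV defu defv.
Qed.

(** Real blocks commute with the conjugation linking the two block rows. *)
Lemma typeII_basis_block_diag n k (U V : 'M[R[i]]_(n, k)) (A B : 'M[R]_k) :
  typeII_basis U V *m block_mx (cplx_mx A) 0 0 (cplx_mx B) =
  typeII_basis (U *m cplx_mx A) (V *m cplx_mx B).
Proof.
rewrite mulmx_block !mulmx0 !addr0 !add0r mulNmx.
by rewrite /typeII_basis !conj_mxM !conj_cplx_mx.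
Qed.

(** * The action of diag(Q, Q^-T) *)

Lemma block_diag_transformE k (Q : 'M[R]_k) :
  block_diag_transform Q =
  block_mx (cplx_mx Q) 0 0 (cplx_mx (invmx Q)^T).
Proof. by rewrite /block_diag_transform -map_invmx cplx_mx_adj. Qed.

Lemma block_diag_transform_unit k (Q : 'M[R]_k) :
  Q \in unitmx -> block_diag_transform Q \in unitmx.
Proof.
move=> uQ; rewrite block_diag_transformE.
by rewrite unitmx_block_diag ?unitmx_cplx_mx ?unitmx_tr ?unitmx_inv.
Qed.

Lemma invmx_block_diag_transform k (Q : 'M[R]_k) :
  Q \in unitmx ->
  invmx (block_diag_transform Q) = block_mx (cplx_mx (invmx Q)) 0 0 (cplx_mx Q^T).
Proof.
move=> uQ; rewrite -[LHS]mulmx1; apply: (canLR (mulKmx _)).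
  exact: block_diag_transform_unit.
rewrite block_diag_transformE mulmx_block !(mulmx0, mul0mx, addr0, add0r).
rewrite -!cplx_mxM -trmx_mul !mulmxV // trmx1.
by rewrite /cplx_mx map_mx1 -scalar_mx_block.
Qed.

Lemma similarity_typeII n k (U V : 'M[R[i]]_(n, k)) u v (F K Q : 'M[R]_k) fv kv :
  Q \in unitmx ->
  let P := (invmx Q)^T in
  similarity (block_diag_transform Q) (typeII_rel U V u v F K fv kv) =
  typeII_rel (U *m cplx_mx Q) (V *m cplx_mx P) u v
             (Q^T *m F *m Q) (P^T *m K *m P) (Q^T *m fv) (P^T *m kv).
Proof.
move=> uQ P; rewrite /similarity /=.
rewrite invmx_block_diag_transform // block_diag_transformE.
rewrite -[block_mx U V _ _]/(typeII_basis U V) typeII_basis_block_diag -/P.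
rewrite /typeII_rel; congr KrylovRel; rewrite !mulmx_block.
  by rewrite !(mulmx0, mul0mx, addr0, add0r) -!cplx_mxM /P trmxK.
rewrite !(mulmx0, mul0mx, addr0, add0r) !cplx_mx_adj -!cplx_mxM.
by rewrite !trmx_mul !trmxK.
Qed.

(** The extended basis also contains the residual vectors, which the
    transformation leaves alone: it acts by [diag(A, 1)] on each half. *)
Lemma row_free_typeII_block_diag n k (U V : 'M[R[i]]_(n, k)) (u v : 'cV_n)
    (A B : 'M[R]_k) :
  A \in unitmx -> B \in unitmx ->
  row_free (typeII_basis (row_mx (U *m cplx_mx A) u) (row_mx (V *m cplx_mx B) v))^T
  = row_free (typeII_basis (row_mx U u) (row_mx V v))^T.
Proof.
move=> uA uB; pose ext (C : 'M[R]_k) : 'M[R]_(k + 1) := block_mx C 0 0 1%:M.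
have row_ext (X : 'M_(n, k)) (x : 'cV_n) C :
    row_mx (X *m cplx_mx C) x = row_mx X x *m cplx_mx (ext C).
  rewrite /cplx_mx map_block_mx map_mx1 !map_mx0 mul_row_block.
  by rewrite !mulmx0 mulmx1 addr0 add0r.
rewrite !row_ext -typeII_basis_block_diag row_free_trmx_mulmx //.
by rewrite unitmx_block_diag // unitmx_cplx_mx unitmx_block_diag ?unitmx1.
Qed.

End TypeII.

Theorem proposition2 (R : realType) (n k : nat) (H : 'M[R[i]]_(n + n))
    (hH : definite_BSE H) (d : krylov_rel R (n + n) (k + k) (1 + 1))
    (hd : is_typeII H d) (Q : 'M[R]_k) (hQ : Q \in unitmx) :
  is_typeII H (similarity (block_diag_transform Q) d).
Proof.
have uP : (invmx Q)^T \in unitmx by rewrite unitmx_tr unitmx_inv.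
have [U [V [u [v [F [K [fv [kv [[holds pF pK free fk0] ->]]]]]]]]] :=
  (is_typeIIP H d).1 hd.
apply/is_typeIIP; do 8!eexists; split; last exact: similarity_typeII.
split; [| exact: symmetric_posdef_congr.. | |].
- rewrite -similarity_typeII //.
  exact/(krylov_holds_similarity _ _ (block_diag_transform_unit hQ)).
- by rewrite row_free_typeII_block_diag.
- by case: fk0 => ->; [left | right]; rewrite mulmx0.
Qed.
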